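(* Let $n\ge 1$, let $\lambda,\mu$ be Young diagrams with at most $n$ rows, and let $\nu$ be a Young diagram with at most $n+1$ rows, such that $\lambda\subset\nu$ and $|\lambda|+|\mu|=|\nu|$. Then the assignment $f\mapsto\Phi(f)$ defines a bijection $$\Phi:\mathbf{P}(\mu,\nu\setminus\lambda)\to\mathbf{B}(\mu)^{\nu}_{\lambda},$$ and the map $\Psi:\mathbf{B}(\mu)^{\nu}_{\lambda}\to\mathbf{P}(\mu,\nu\setminus\lambda)$, $T\mapsto\Psi(T)$, is the inverse of $\Phi$.
   Context: Young diagrams: a Young diagram is a partition $\lambda=(\lambda_1\ge\lambda_2\ge\cdots\ge\lambda_m\ge 0)$, with $\lambda_i=0$ for $i>m$, identified with the set of boxes $\{(i,j)\in\mathbb{N}\times\mathbb{N}: i\ge 1,\ 1\le j\le\lambda_i\}$ ($i$ is the row index counted from the top, $j$ the column index counted from the left); $|\lambda|$ is its number of boxes. For $\lambda\subset\nu$, the skew diagram $\nu\setminus\lambda$ is the set difference. Young tableaux: $\mathbf{B}(\mu)$ is the set of Young tableaux of shape $\mu$ with entries in $\{1,\dots,n+1\}$, i.e. fillings $T=(T_{i,j})_{(i,j)\in\mu}$ weakly increasing from left to right in each row and strictly increasing from top to bottom in each column (it underlies the crystal of type $A_n$ of highest weight $\mu$). Pictures: on subsets of $\mathbb{N}\times\mathbb{N}$, $(a,b)\le_P(c,d)$ iff $a\le c$ and $b\le d$; and $(a,b)\le_J(c,d)$ iff $a<c$, or $a=c$ and $b\ge d$. A map $f:X\to Y$ between subsets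 of $\mathbb{N}\times\mathbb{N}$ is PJ-standard if $x\le_P x'$ implies $f(x)\le_J f(x')$ for all $x,x'\in X$. A picture is a bijection $f:X\to Y$ such that both $f$ and $f^{-1}$ are PJ-standard. $\mathbf{P}(\mu,\nu\setminus\lambda)$ is the set of pictures $f:\mu\to\nu\setminus\lambda$. Middle-eastern reading and addition: for a filling $T$ of $\mu$ with $N=|\mu|$, the middle-eastern reading $\mathrm{ME}(T)$ is the sequence $i_1,\dots,i_N$ (written as the tensor product of the one-box tableaux $i_1\otimes\cdots\otimes i_N$) of entries of $T$ read in each row from right to left, the rows being taken from top to bottom. For $i\in\{1,\dots,n+1\}$, $\lambda[i]$ is obtained from $\lambda=(\lambda_1,\lambda_2,\dots)$ by replacing $\lambda_i$ by $\lambda_i+1$, and $\lambda[i_1,\dots,i_k]:=(\cdots((\lambda[i_1])[i_2])\cdots)[i_k]$; this need not be a Young diagram (i.e. weakly decreasing). Littlewood-Richardson crystals: $\mathbf{B}(\mu)^{\nu}_{\lambda}$ is the set of $T\in\mathbf{B}(\mu)$ such that, writing $\mathrm{ME}(T)=i_1\otimes\cdots\otimes i_N$, $\lambda[i_1,\dots,i_k]$ is a Young diagram for every $k=1,\dots,N$, and $\lambda[i_1,\dots,i_N]=\nu$. The maps: for $f=(f_1,f_2)\in\mathbf{P}(\mu,\nu\setminus\lambda)$, $\Phi(f)$ is the filling of $\mu$ with $\Phi(f)_{i,j}:=f_1(i,j)$, where $f_1$ denotes the first (row) coordinate of $f$. For $T\in\mathbf{B}(\mu)^{\nu}_{\lambda}$,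 $\Psi(T)$ is the map on $\mu$ given by $\Psi(T)(i,j):=(T_{i,j},\ \lambda_{T_{i,j}}+p(T;i,j))$, where $p(T;i,j)$ is the position, counted from the right, of the box $(i,j)$ among the boxes of $T$ having the same entry $T_{i,j}$ (no two such boxes lie in the same column); i.e. $p(T;i,j)=\#\{(a,b)\in\mu: T_{a,b}=T_{i,j},\ b\ge j\}$. *)

(* Defs.v *)
From mathcomp Require Import all_boot.
From mathcomp Require Import classical_sets functions.

Set Implicit Arguments.
Unset Strict Implicit.
Unset Printing Implicit Defensive.

Local Open Scope classical_set_scope.

(* A box (i, j) has row index i >= 1 and column index j >= 1. *)
Definition cell : Type := (nat * nat)%type.

(* lambda_i, with i >= 1; it is 0 beyond the last part. *)
Definition part (la : seq nat) (i : nat) : nat := nth 0 la i.-1.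

(* Trailing zeros are not stored: a diagram is the weakly decreasing list of
   its nonzero row lengths, so that equality of diagrams is equality of lists
   and the number of rows is [size la]. *)
Definition young_diagram (la : seq nat) : bool :=
  sorted geq la && (0 \notin la).

(* Rows from top to bottom, each row from right to left (the order of the
   middle-eastern reading). *)
Definition cells (la : seq nat) : seq cell :=
  [seq (i, j) | i <- iota 1 (size la), j <- rev (iota 1 (part la i))].

Definition skew (nu la : seq nat) : seq cell :=
  [seq x <- cells nu | x \notin cells la].

Lemma mem_cells la i j :
  ((i, j) \in cells la) = (1 <= i) && (1 <= j <= part la i).
Proof.
apply/allpairsPdep/idP => [[a [b [+ + [-> ->]]]]|/andP[i1 /andP[j1 ji]]].
  by rewrite mem_rev !mem_iota add1n ltnS => /andP[-> _].
exists i, j; rewrite mem_rev !mem_iota !add1n !ltnS i1 j1 ji; split=> //.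
case: i i1 ji => // i _; rewrite /part /= => ji.
by rewrite ltnNge; apply: contraTN ji => /(nth_default 0) ->; rewrite -ltnNge.
Qed.

Lemma cells_uniq la : uniq (cells la).
Proof.
apply: allpairs_uniq_dep; first exact: iota_uniq.
  by move=> i _; rewrite rev_uniq iota_uniq.
by move=> [a b] [c d] _ _ /= [-> ->].
Qed.

Definition le_P (x y : cell) : bool := (x.1 <= y.1) && (x.2 <= y.2).

Definition le_J (x y : cell) : bool :=
  (x.1 < y.1) || (x.1 == y.1) && (x.2 >= y.2).

Definition PJ_standard (X Y : seq cell) (f : seq_sub X -> seq_sub Y) : Prop :=
  forall x x' : seq_sub X,
    le_P (val x) (val x') -> le_J (val (f x)) (val (f x')).

Definition is_picture (X Y : seq cell) (f : seq_sub X -> seq_sub Y) : Prop :=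
  PJ_standard f /\
  exists g : seq_sub Y -> seq_sub X, [/\ cancel f g, cancel g f & PJ_standard g].

(* The pictures from mu to nu \ la, regarded as N x N-valued functions on the
   boxes of mu. *)
Definition pictures (mu nu la : seq nat) :
    set {ffun seq_sub (cells mu) -> cell} :=
  [set f | exists2 h : seq_sub (cells mu) -> seq_sub (skew nu la),
             is_picture h & forall x, f x = val (h x)].
Arguments pictures : clear implicits.

Definition filling (mu : seq nat) : Type := {ffun seq_sub (cells mu) -> nat}.

Definition young_tableaux (n : nat) (mu : seq nat) : set (filling mu) :=
  [set T | [/\ forall x, 1 <= T x <= n.+1,
               forall x y, (val x).1 = (val y).1 -> (val x).2 <= (val y).2 ->
                 T x <= T y
             & forall x y, (val x).2 = (val y).2 -> (val x).1 < (val y).1 ->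
                 T x < T y]].
Arguments young_tableaux : clear implicits.

(* [pmap insub (cells mu)] is the list [cells mu] with each box bundled with
   the proof that it belongs to mu; no box is dropped. *)
Definition ME (mu : seq nat) (T : filling mu) : seq nat :=
  [seq T x | x <- pmap insub (cells mu)].

(* la[i] for i >= 1; [incr_nth] counts from 0 and pads with zeros. *)
Definition add_box (la : seq nat) (i : nat) : seq nat := incr_nth la i.-1.

Definition add_boxes (la : seq nat) (s : seq nat) : seq nat :=
  foldl add_box la s.

Definition LR_crystal (n : nat) (mu nu la : seq nat) : set (filling mu) :=
  [set T | [/\ young_tableaux n mu T,
               forall k, 1 <= k <= size (ME T) ->
                 young_diagram (add_boxes la (take k (ME T)))
             & add_boxes la (ME T) = nu]].
Arguments LR_crystal : clear implicits.

Definition Phi (mu : seq nat) (f : {ffun seq_sub (cells mu) -> cell}) :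
    filling mu :=
  [ffun x => (f x).1].

Definition pos_from_right (mu : seq nat) (T : filling mu)
    (x : seq_sub (cells mu)) : nat :=
  #|[pred y : seq_sub (cells mu) | (T y == T x) && ((val x).2 <= (val y).2)]|.

Definition Psi (la mu : seq nat) (T : filling mu) :
    {ffun seq_sub (cells mu) -> cell} :=
  [ffun x => (T x, part la (T x) + pos_from_right T x)].
Arguments Psi la {mu} T.

(* Main.v *)
Require Import Defs.
From mathcomp Require Import all_boot.
From mathcomp Require Import classical_sets functions.
From mathcomp Require Import zify.

(** The order [le_J] is the order in which the middle-eastern reading visits
    the boxes: [y] is read no later than [x] iff [le_J y x].  So every prefix
    of the reading ends at some box [x], and after that prefix row [r] of the
    growing shape has length
      la_r + #{y | T y = r, y read no later than x}     ([part_reading]).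
    Both directions of the correspondence are statements about this count.

    Let [f] be a picture and [T = Phi f].  On the boxes that [f] sends to a
    given row of nu \ la, the column of the image grows along the reading
    order ([picture_row_order]), because the inverse of [f] sends the P-order
    to the J-order.  Hence the column of [f x] is recovered by counting the
    boxes with the same entry read no later than [x], and in a tableau these
    are the boxes with the same entry lying weakly to the right
    ([same_entry_order]); this is [Psi la (Phi f) = f].  The same monotonicity
    says that the boxes read so far have an image closed downwards in nu \ la
    for the P-order, so that adding it to la gives a Young diagram
    ([Phi_reading_young]).

    Let [T] be in the Littlewood-Richardson crystal.  The content of [T] puts
    the values of [Psi la T] in nu \ la, equal entries get different columns,
    and equality of cardinals makes [Psi la T] a bijection.  It sends the
    P-order to the J-order since [T] is weakly increasing along the P-order.
    For the inverse, if the image of [x] lies weakly north-west of that of [y]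
    while [y] were read before [x], then at the time [y] is read the row [T x]
    would still be too short for the row [T y] below it, against the lattice
    condition ([Psi_inv_mono]).  Finally [Phi (Psi la T) = T] by
    definition. *)

Set Implicit Arguments.
Unset Strict Implicit.
Unset Printing Implicit Defensive.

(** * Young diagrams *)

Lemma geq_trans : transitive geq.
Proof. by move=> a b c ab ca; apply: leq_trans ca ab. Qed.

Lemma part_le la i j :
  young_diagram la -> 0 < i -> i <= j -> part la j <= part la i.
Proof.
move=> /andP[la_sorted _] i_gt0 ij; rewrite /part.
have [la_j|j_la] := ltnP j.-1 (size la); last by rewrite nth_default.
have geq_refl : reflexive geq by move=> a; apply: leqnn.
apply: (sorted_leq_nth geq_trans geq_refl 0 la_sorted); rewrite ?inE; lia.
Qed.

(** Stated through [last] since trailing zeros are the only obstruction to a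
    weakly decreasing list being a list of positive parts, and [incr_nth] never
    creates one ([last_incr_nth]). *)
Lemma young_diagramP s :
    last 1 s != 0 -> (forall i, 0 < i -> part s i.+1 <= part s i) ->
  young_diagram s.
Proof.
move=> s_last s_mono.
have s_sorted : sorted geq s.
  by apply/(sortedP 0) => i _; apply: (s_mono i.+1).
rewrite /young_diagram s_sorted /=.
elim/last_ind: s s_last s_sorted {s_mono} => // s x _.
rewrite last_rcons => x_neq0.
rewrite (sorted_pairwise geq_trans) pairwise_rcons.
rewrite mem_rcons inE negb_or eq_sym x_neq0 => /andP[/allP s_ge _] /=.
by apply/negP => /s_ge; rewrite /geq /= leqn0 (negPf x_neq0).
Qed.

Lemma last_young s : young_diagram s -> last 1 s != 0.
Proof.
case/lastP: s => // s x /andP[_]; rewrite last_rcons mem_rcons inE negb_or.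
by rewrite eq_sym => /andP[].
Qed.

(** Two diagrams with the same parts could only differ by trailing zeros, and
    diagrams store none. *)
Lemma young_diagram_inj s t :
    young_diagram s -> young_diagram t ->
  (forall i, 0 < i -> part s i = part t i) -> s = t.
Proof.
suff le_size u v : young_diagram v ->
    (forall i, 0 < i -> part u i = part v i) -> size v <= size u.
  move=> s_young t_young st; apply: (@eq_from_nth _ 0).
    by apply/eqP; rewrite eqn_leq !le_size // => i i_gt0; rewrite st.
  by move=> i _; apply: (st i.+1).
move=> /andP[_ v_neq0] uv; rewrite leqNgt; apply: contra v_neq0 => uv_size.
have := uv (size u).+1 isT; rewrite /part /= nth_default // => ->.
exact: mem_nth.
Qed.

Lemma last_incr_nth s i : last 1 s != 0 -> last 1 (incr_nth s i) != 0.
Proof.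
have pad x k : last x (ncons k 0 [:: 1]) = 1 by elim: k x => //= k IHk x.
elim: s i => [|x s IHs] [|i] //=; first by rewrite pad.
  by case: s {IHs}.
case: s IHs => [_ _|y s IHs ys_last]; last by have := IHs i ys_last; case: i.
by case: i => //= i; rewrite pad.
Qed.

Lemma last_add_boxes la s : last 1 la != 0 -> last 1 (add_boxes la s) != 0.
Proof.
by elim: s la => //= i s IHs la la_last; apply/IHs/last_incr_nth.
Qed.

Lemma part_add_boxes la s r :
    all (leq 1) s -> 0 < r ->
  part (add_boxes la s) r = part la r + count_mem r s.
Proof.
move=> s_gt0 r_gt0; elim: s s_gt0 la => [|i s IHs] /= => [_ la|].
  by rewrite addn0.
move=> /andP[i_gt0 s_gt0] la; rewrite IHs // /part /add_box nth_incr_nth.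
have -> : (i.-1 == r.-1) = (i == r) by lia.
by rewrite addnCA addnA.
Qed.

(** * Counting boxes of a skew diagram *)

Lemma mem_skew nu la r c :
  ((r, c) \in skew nu la) = [&& 0 < r, part la r < c & c <= part nu r].
Proof. by rewrite mem_filter !mem_cells; lia. Qed.

Lemma skew_uniq nu la : uniq (skew nu la).
Proof. by rewrite filter_uniq ?cells_uniq. Qed.

Lemma size_skew nu la :
    {subset cells la <= cells nu} ->
  size (skew nu la) = size (cells nu) - size (cells la).
Proof.
move=> la_nu; rewrite size_filter -(count_predC (mem (cells la)) (cells nu)).
suff -> : count (mem (cells la)) (cells nu) = size (cells la) by rewrite addKn.
rewrite -size_filter; apply/perm_size/uniq_perm.
- by rewrite filter_uniq ?cells_uniq.
- exact: cells_uniq.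
by move=> z; rewrite mem_filter; apply: andb_idr; apply: la_nu.
Qed.

(** The minimum and the truncated subtraction make one formula serve also when
    [c] lies beyond row [r] of [nu] or inside row [r] of [la]. *)
Lemma count_skew_row nu la r c :
    0 < r ->
  count [pred z : cell | (z.1 == r) && (z.2 <= c)] (skew nu la)
    = minn c (part nu r) - part la r.
Proof.
move=> r_gt0; rewrite -size_filter.
set m := minn _ _ - _.
rewrite -[m](size_iota (part la r).+1) -(size_map (pair r) (iota _ _)) {}/m.
apply/perm_size/uniq_perm.
- by rewrite filter_uniq ?skew_uniq.
- by rewrite map_inj_uniq ?iota_uniq // => i j [].
move=> [a b]; rewrite mem_filter mem_skew /=.
apply/idP/mapP => [H|[j + [-> ->]]]; last by rewrite mem_iota; lia.
have ar : a = r by lia.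
by exists b; rewrite ?ar // mem_iota; move: H; rewrite ar; lia.
Qed.

Lemma card_seq_sub_val (X : choiceType) (s : seq X) (P : pred X) :
  uniq s -> #|[pred x : seq_sub s | P (val x)]| = count P s.
Proof.
move=> s_uniq; rewrite -size_filter cardE -(size_map val (enum _)).
apply/perm_size/uniq_perm.
- by rewrite (map_inj_uniq val_inj) enum_uniq.
- exact: filter_uniq.
move=> x; rewrite mem_filter; apply/mapP/andP => [[y + ->]|[Px xs]].
  by rewrite mem_enum inE => ->; rewrite (valP y).
by exists (SeqSub xs); rewrite ?mem_enum.
Qed.

(** * The reading order *)

Lemma le_J_refl : reflexive le_J.
Proof. by move=> a; rewrite /le_J eqxx leqnn orbT. Qed.

Lemma le_J_total (a b : cell) : le_J a b || le_J b a.
Proof. by rewrite /le_J; lia. Qed.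

Lemma le_J_anti : antisymmetric le_J.
Proof. by move=> [a b] [c d]; rewrite /le_J /= => H; congr pair; lia. Qed.

Lemma le_J_trans : transitive le_J.
Proof. by move=> [a b] [c d] [e f]; rewrite /le_J /=; lia. Qed.

Lemma pairwise_cells mu : pairwise le_J (cells mu).
Proof.
rewrite /cells; move: (part mu) => w.
have row i m : pairwise le_J [seq (i, j) | j <- rev (iota 1 m)].
  rewrite pairwise_map -sorted_pairwise; last first.
    by move=> a b c; rewrite /le_J /=; lia.
  rewrite rev_sorted; apply: sub_sorted (iota_sorted 1 m).
  by move=> a b ab; rewrite /le_J /= ltnn eqxx.
have rows m i :
    pairwise le_J [seq (a, j) | a <- iota i m, j <- rev (iota 1 (w a))];
  last exact: rows.
elim: m i => //= m IHm i.
rewrite pairwise_cat IHm row !andbT; apply/allrelP => x y.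
move=> /mapP[j _ ->] /allpairsPdep[a [b [+ _ ->]]].
by rewrite mem_iota /le_J /=; lia.
Qed.

Definition boxes (mu : seq nat) : seq (seq_sub (cells mu)) :=
  pmap insub (cells mu).

Lemma map_val_boxes mu : map val (boxes mu) = cells mu.
Proof.
rewrite pmap_filter; last by move=> x; apply: insubK.
rewrite (eq_in_filter (a2 := predT)) ?filter_predT // => x xmu.
by rewrite isSome_insub.
Qed.

Lemma mem_boxes mu x : x \in boxes mu.
Proof. by rewrite mem_pmap_sub (valP x). Qed.

Lemma boxes_uniq mu : uniq (boxes mu).
Proof. by rewrite pmap_sub_uniq ?cells_uniq. Qed.

Lemma card_boxes mu (P : pred (seq_sub (cells mu))) :
  #|P| = count P (boxes mu).
Proof.
rewrite -size_filter cardE; apply/perm_size/uniq_perm.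
- exact: enum_uniq.
- by rewrite filter_uniq ?boxes_uniq.
by move=> x; rewrite mem_enum mem_filter mem_boxes andbT.
Qed.

(** The reading lists the boxes in [le_J]-increasing order, so its prefix
    ending at [x] is the initial segment below [x]. *)
Lemma mem_take_boxes mu (x y : seq_sub (cells mu)) :
  (y \in take (index x (boxes mu)).+1 (boxes mu)) = le_J (val y) (val x).
Proof.
rewrite in_take ?mem_boxes // ltnS.
have pw : pairwise (relpre val le_J) (boxes mu).
  by rewrite -pairwise_map map_val_boxes pairwise_cells.
have tr : transitive (relpre (val : seq_sub (cells mu) -> cell) le_J).
  by move=> ? ? ?; apply: le_J_trans.
have so := pairwise_sorted pw.
apply/idP/idP => [|yx].
  apply: (sorted_leq_index tr) => //; rewrite ?mem_boxes // => z.
  exact: le_J_refl.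
rewrite leqNgt; apply/negP => lt_xy.
have xy : le_J (val x) (val y).
  exact: (sorted_ltn_index tr so x y (mem_boxes x) (mem_boxes y) lt_xy).
suff x_y : x = y by rewrite x_y ltnn in lt_xy.
by apply/val_inj/le_J_anti; rewrite xy yx.
Qed.

(** This turns the lattice condition, about prefixes of a word, into a
    condition about numbers of boxes below a given one in the reading order. *)
Lemma part_reading la mu (T : filling mu) x r :
    (forall y, 0 < T y) -> 0 < r ->
  part (add_boxes la (take (index x (boxes mu)).+1 (ME T))) r
    = part la r + #|[pred y | (T y == r) && le_J (val y) (val x)]|.
Proof.
move=> T_gt0 r_gt0; rewrite part_add_boxes //; last first.
  by apply/allP => i /mem_take /mapP[y _ ->].
congr (_ + _); rewrite /ME -map_take count_map -/(boxes mu) -size_filter.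
rewrite cardE; apply/perm_size/uniq_perm.
- by rewrite filter_uniq ?take_uniq ?boxes_uniq.
- exact: enum_uniq.
by move=> y; rewrite mem_filter mem_take_boxes mem_enum.
Qed.

Lemma part_add_ME la mu (T : filling mu) r :
    (forall y, 0 < T y) -> 0 < r ->
  part (add_boxes la (ME T)) r = part la r + #|[pred y | T y == r]|.
Proof.
move=> T_gt0 r_gt0; rewrite part_add_boxes // ?card_boxes ?count_map //.
by apply/allP => i /mapP[y _ ->].
Qed.

(** * Tableaux along the two orders *)

Lemma corner mu (x y : seq_sub (cells mu)) :
    young_diagram mu -> (val x).1 <= (val y).1 ->
  exists z : seq_sub (cells mu), val z = ((val x).1, (val y).2).
Proof.
case: x y => [[a b] xmu] [[c d] ymu] /= mu_young ac.
suff zmu : (a, d) \in cells mu by exists (SeqSub zmu).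
move: (xmu) (ymu); rewrite !mem_cells => /andP[a_gt0 _] /andP[_ d_c].
by have := part_le mu_young a_gt0 ac; lia.
Qed.

(** Go right along the row of [x] to the column of [y], then strictly down. *)
Lemma tableau_lt n mu (T : filling mu) x y :
    young_diagram mu -> young_tableaux n mu T ->
    (val x).1 < (val y).1 -> (val x).2 <= (val y).2 ->
  T x < T y.
Proof.
move=> mu_young [_ T_row T_col] xy1 xy2.
have [z zE] := corner mu_young (ltnW xy1).
apply: (@leq_ltn_trans (T z)); first by apply: T_row; rewrite zE.
by apply: T_col; rewrite zE.
Qed.

Lemma tableau_le n mu (T : filling mu) x y :
    young_diagram mu -> young_tableaux n mu T -> le_P (val x) (val y) ->
  T x <= T y.
Proof.
move=> mu_young T_tab /andP[]; rewrite leq_eqVlt => /orP[/eqP xy1|xy1] xy2.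
  by case: T_tab => _ T_row _; apply: T_row.
exact/ltnW/(tableau_lt mu_young T_tab).
Qed.

(** By [tableau_lt], of two boxes with the same entry none is strictly below
    and weakly right of the other; they are placed from south-west to
    north-east, so that reading earlier means lying further right. *)
Lemma same_entry_order n mu (T : filling mu) x y :
    young_diagram mu -> young_tableaux n mu T -> T y = T x ->
  ((val x).2 <= (val y).2) = le_J (val y) (val x).
Proof.
move=> mu_young T_tab Tyx.
have := @tableau_lt n mu T x y mu_young T_tab.
have := @tableau_lt n mu T y x mu_young T_tab.
rewrite Tyx ltnn /le_J.
by case: (val x) (val y) => [a b] [c d] /=; lia.
Qed.

Lemma pos_from_rightE n mu (T : filling mu) x :
    young_diagram mu -> young_tableaux n mu T ->
  pos_from_right T x = #|[pred y | (T y == T x) && le_J (val y) (val x)]|.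
Proof.
move=> mu_young T_tab; apply: eq_card => y; rewrite !inE.
case: eqP => //= Tyx; exact: (same_entry_order mu_young T_tab Tyx).
Qed.

(** * From pictures to Littlewood-Richardson tableaux *)

Section PictureToTableau.
Variables (la mu nu : seq nat) (f : {ffun seq_sub (cells mu) -> cell}).
Hypothesis f_pict : pictures mu nu la f.

Lemma picture_mem x : f x \in skew nu la.
Proof. by case: f_pict => h _ ->; apply: valP. Qed.

Lemma picture_mono x y : le_P (val x) (val y) -> le_J (f x) (f y).
Proof. by case: f_pict => h [h_std _] fE; rewrite !fE; apply: h_std. Qed.

Lemma picture_inv_mono x y : le_P (f x) (f y) -> le_J (val x) (val y).
Proof.
case: f_pict => h [_ [g [hK _ g_std]]] fE; rewrite !fE => /g_std.
by rewrite !hK.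
Qed.

Lemma card_picture (P : pred cell) :
  #|[pred x | P (f x)]| = count P (skew nu la).
Proof.
case: f_pict => h [_ [g [hK gK _]]] fE.
rewrite -card_seq_sub_val ?skew_uniq // -(on_card_preimset (f := h)).
  by rewrite cardsE; apply: eq_card => x; rewrite !inE fE.
by exists g => x _; rewrite ?hK ?gK.
Qed.

Lemma card_picture_row r c :
    0 < r ->
  #|[pred x | ((f x).1 == r) && ((f x).2 <= c)]|
    = minn c (part nu r) - part la r.
Proof.
by move=> r_gt0; rewrite -(count_skew_row nu la c r_gt0) -card_picture.
Qed.

Lemma picture_bounds x :
  [/\ 0 < (f x).1, part la (f x).1 < (f x).2 & (f x).2 <= part nu (f x).1].
Proof.
by have := picture_mem x; case: (f x) => r c; rewrite mem_skew => /and3P[].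
Qed.

(** If [y] comes no later than [x] in the reading but [f y] lies strictly to
    the right of [f x], then the inverse of [f] also puts [x] no later than
    [y], so that [x = y], a contradiction. *)
Lemma picture_row_order x y :
  (f y).1 = (f x).1 -> ((f y).2 <= (f x).2) = le_J (val y) (val x).
Proof.
move=> fyx; apply/idP/idP => [le_yx|yx].
  by apply: picture_inv_mono; rewrite /le_P fyx leqnn.
rewrite leqNgt; apply/negP => lt_xy.
have xy : le_J (val x) (val y).
  by apply: picture_inv_mono; rewrite /le_P fyx leqnn ltnW.
have x_y : x = y by apply/val_inj/le_J_anti; rewrite xy yx.
by rewrite x_y ltnn in lt_xy.
Qed.

(** Columns are strict: if [y] is below [x] in its column and the images share
    a row, then [f y] lies weakly to the left of [f x], and the inverse of [f]
    would put [y] before [x]. *)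
Lemma Phi_tableau n : size nu <= n.+1 -> young_tableaux n mu (Phi f).
Proof.
move=> nu_rows; split=> [x|x y xy1 xy2|x y xy2 xy1]; rewrite !ffunE.
- have [r_gt0 la_c c_nu] := picture_bounds x; rewrite r_gt0 leqNgt.
  apply/negP => n_r; move: c_nu; rewrite /part [nth _ nu _]nth_default; lia.
- have : le_J (f x) (f y) by apply: picture_mono; rewrite /le_P xy1 leqnn.
  by rewrite /le_J; lia.
have fxy : le_J (f x) (f y).
  by apply: picture_mono; rewrite /le_P xy2 leqnn ltnW.
rewrite ltnNge; apply/negP => le_yx.
have : le_J (val y) (val x).
  by apply: picture_inv_mono; move: fxy; rewrite /le_J /le_P; lia.
by rewrite /le_J; lia.
Qed.

(** Row [(f x).1] of the skew diagram is filled from left to right along the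
    reading, so the boxes with the same entry read no later than [x] are sent
    onto the columns from [part la (f x).1 + 1] to [(f x).2]. *)
Lemma Psi_Phi : young_diagram mu -> Psi la (Phi f) = f.
Proof.
move=> mu_young.
have T_tab : young_tableaux (size nu) mu (Phi f).
  exact/Phi_tableau/leqnSn.
apply/ffunP => x; rewrite !ffunE (pos_from_rightE _ mu_young T_tab).
have [r_gt0 la_c c_nu] := picture_bounds x.
have -> : #|[pred y | (Phi f y == Phi f x) && le_J (val y) (val x)]|
          = (f x).2 - part la (f x).1.
  rewrite -[in RHS](minn_idPl c_nu) -card_picture_row //.
  apply: eq_card => y; rewrite !inE !ffunE.
  by case: eqP => //= fyx; rewrite picture_row_order.
by rewrite subnKC ?(ltnW la_c) // -surjective_pairing.
Qed.

(** Suppose that [m > 0] boxes read so far went to row [r + 1].  One of them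
    was sent to column [c = part la r.+1 + m] or beyond; all boxes of row [r]
    of the skew diagram up to column [c] lie north-west of its image, hence
    were filled earlier, so row [r] has length at least [c]. *)
Lemma Phi_reading_young x :
    young_diagram la -> young_diagram nu ->
  young_diagram
    (add_boxes la (take (index x (boxes mu)).+1 (ME (Phi f)))).
Proof.
move=> la_young nu_young; apply: young_diagramP => [|r r_gt0].
  exact/last_add_boxes/last_young.
have T_gt0 y : 0 < Phi f y by rewrite ffunE; case: (picture_bounds y).
rewrite !part_reading //.
set m := #|[pred y | (_ == r.+1) && _]|; set a := #|_|.
have [m0|m_gt0] := posnP m.
  by rewrite m0 addn0; have := part_le la_young r_gt0 (leqnSn r); lia.
set c := part la r.+1 + m.
(* Otherwise the m boxes would have images in fewer than m columns. *)
have [y /and3P[/eqP fy1 y_x le_cy]] :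
    exists y, [&& (f y).1 == r.+1, le_J (val y) (val x) & c <= (f y).2].
  apply/existsP; rewrite -[[exists _, _]]negbK negb_exists.
  apply/negP => /forallP noy.
  suff : m <= #|[pred y | ((f y).1 == r.+1) && ((f y).2 <= c.-1)]|.
    by rewrite card_picture_row // /c; lia.
  rewrite /m; apply/subset_leq_card/fintype.subsetP => y.
  rewrite !inE ffunE => /andP[fy yx].
  by have := noy y; rewrite fy yx /=; lia.
have : #|[pred z | ((f z).1 == r) && ((f z).2 <= c)]| <= a.
  rewrite /a; apply/subset_leq_card/fintype.subsetP => z.
  rewrite !inE ffunE => /andP[fz zc].
  rewrite fz /=; apply: le_J_trans y_x; apply: picture_inv_mono.
  by rewrite /le_P fy1; lia.
rewrite card_picture_row //.
have [_ _] := picture_bounds y; rewrite fy1.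
by have := part_le nu_young r_gt0 (leqnSn r); lia.
Qed.
End PictureToTableau.

(** * From Littlewood-Richardson tableaux to pictures *)

Section TableauToPicture.
Variables (n : nat) (la mu nu : seq nat) (T : filling mu).
Hypothesis mu_young : young_diagram mu.
Hypothesis T_LR : LR_crystal n mu nu la T.

Let T_tab : young_tableaux n mu T. Proof. by case: T_LR. Qed.

Let T_gt0 x : 0 < T x.
Proof. by case: T_tab => T_range _ _; case/andP: (T_range x). Qed.

Lemma LR_reading_young x :
  young_diagram (add_boxes la (take (index x (boxes mu)).+1 (ME T))).
Proof.
case: T_LR => _ T_lattice _; apply: T_lattice.
by rewrite size_map -/(boxes mu) index_mem mem_boxes.
Qed.

Lemma LR_content r : 0 < r -> part nu r = part la r + #|[pred y | T y == r]|.
Proof. by case: T_LR => _ _ <- r_gt0; apply: part_add_ME. Qed.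

Lemma Psi_mem x : Psi la T x \in skew nu la.
Proof.
rewrite ffunE mem_skew T_gt0 LR_content // leq_add2l -[ltnLHS]addn0 ltn_add2l.
apply/and3P; split=> //; rewrite ?leqnn /pos_from_right.
  by apply/card_gt0P; exists x; rewrite !inE eqxx leqnn.
by apply/subset_leq_card/fintype.subsetP => y; rewrite !inE => /andP[].
Qed.

(** The boxes with this entry read no later than [x] include those read no
    later than [y], and [x] itself, which is read after [y]. *)
Lemma pos_from_right_lt x y :
    T y = T x -> le_J (val y) (val x) -> y != x ->
  pos_from_right T y < pos_from_right T x.
Proof.
move=> Tyx yx y_neq_x; rewrite !(pos_from_rightE _ mu_young T_tab) Tyx.
apply/proper_card/properP; split.
  apply/fintype.subsetP => z; rewrite !inE => /andP[-> zy] /=.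
  exact: le_J_trans zy yx.
exists x; rewrite !inE eqxx /= ?le_J_refl //.
apply/negP => xy; case/eqP: y_neq_x.
by apply/val_inj/le_J_anti; rewrite yx xy.
Qed.

Lemma Psi_inj : injective (Psi la T).
Proof.
move=> x y; rewrite !ffunE => -[Txy]; rewrite Txy => /addnI pos_xy.
apply/eqP; apply: contraT => x_neq_y.
have [xy|yx] := orP (le_J_total (val x) (val y)).
  by have := pos_from_right_lt Txy xy x_neq_y; rewrite pos_xy ltnn.
rewrite eq_sym in x_neq_y.
by have := pos_from_right_lt (esym Txy) yx x_neq_y; rewrite pos_xy ltnn.
Qed.

(** When the entries are equal, [y] lies weakly to the right of [x], so that
    its position from the right is not larger: inside a row, [le_J] runs from
    right to left. *)
Lemma Psi_mono x y :
  le_P (val x) (val y) -> le_J (Psi la T x) (Psi la T y).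
Proof.
move=> xy; rewrite !ffunE /le_J /=.
have := tableau_le mu_young T_tab xy; rewrite leq_eqVlt => /predU1P[Txy|->//].
rewrite Txy eqxx leq_add2l orbC /=; apply/orP; left.
apply/subset_leq_card/fintype.subsetP => z; rewrite !inE Txy => /andP[-> yz] /=.
by case/andP: xy => _ xy2; apply: leq_trans yz.
Qed.

(** Assume that [y] is read no later than [x].  After reading [y] the shape has
    column [(Psi la T y).2] in row [T y], hence also in the higher row [T x]
    by the lattice condition at [y].  So as many boxes with entry [T x] are
    read up to [y] as up to [x], which forces [x] itself to be among them. *)
Lemma Psi_inv_mono x y :
  le_P (Psi la T x) (Psi la T y) -> le_J (val x) (val y).
Proof.
rewrite !ffunE => /andP[/= Txy pos_xy].
have [//|yx] := orP (le_J_total (val x) (val y)).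
have := part_le (LR_reading_young y) (T_gt0 x) Txy.
rewrite !part_reading // -(pos_from_rightE _ mu_young T_tab).
move=> /(leq_trans pos_xy); rewrite leq_add2l (pos_from_rightE _ mu_young T_tab).
(* A and B: the boxes with entry T x read up to x, resp. up to y. *)
set A := [pred z | _ && le_J _ (val x)]; set B := [pred z | _ && _] => AB.
have BA : B \subset A.
  apply/fintype.subsetP => z; rewrite !inE => /andP[-> zy] /=.
  exact: le_J_trans zy yx.
have [|xB] := boolP (x \in B); first by rewrite inE eqxx.
suff : #|B| < #|A| by rewrite ltnNge AB.
apply/proper_card/properP; split=> //; exists x => //.
by rewrite inE eqxx le_J_refl.
Qed.

(** Surjectivity comes for free: [Psi la T] is injective between finite sets
    that have the same cardinal by [card_eq]. *)
Lemma Psi_picture :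
    {subset cells la <= cells nu} ->
    size (cells la) + size (cells mu) = size (cells nu) ->
  pictures mu nu la (Psi la T).
Proof.
move=> la_nu card_eq.
pose h x : seq_sub (skew nu la) := SeqSub (Psi_mem x).
have h_inj : injective h by move=> x y /(congr1 val) /Psi_inj.
have card_h : #|{: seq_sub (skew nu la)}| <= #|{: seq_sub (cells mu)}|.
  by rewrite !card_seq_sub ?skew_uniq ?cells_uniq // size_skew // -card_eq addKn.
have [g hK gK] := inj_card_bij h_inj card_h.
exists h => //; split; first by move=> x y; apply: Psi_mono.
exists g; split=> // z z' zz'; apply: Psi_inv_mono.
by rewrite -[Psi la T _]/(val (h _)) -[Psi la T (g z')]/(val (h _)) !gK.
Qed.
End TableauToPicture.

(** * The bijection *)

(** All the rows of the skew diagram are filled at the end of the reading, so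
    the final shape has the parts of [nu]. *)
Lemma Phi_LR n la mu nu (f : {ffun seq_sub (cells mu) -> cell}) :
    young_diagram la -> young_diagram nu ->
    size nu <= n.+1 -> {subset cells la <= cells nu} ->
  pictures mu nu la f -> LR_crystal n mu nu la (Phi f).
Proof.
move=> la_young nu_young nu_rows la_nu f_pict.
have T_gt0 y : 0 < Phi f y by rewrite ffunE; case: (picture_bounds f_pict y).
have lattice k : k <= size (ME (Phi f)) ->
    young_diagram (add_boxes la (take k (ME (Phi f)))).
  case: k => [_|k]; first by rewrite take0.
  rewrite size_map -/(boxes mu) => k_lt.
  have x0 : seq_sub (cells mu) by case: (boxes mu) k_lt.
  rewrite -(index_uniq x0 k_lt (boxes_uniq mu)).
  exact: (Phi_reading_young f_pict).
split; first exact: Phi_tableau f_pict _ nu_rows.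
  by move=> k /andP[_]; apply: lattice.
apply: young_diagram_inj => // [|r r_gt0].
  by have := lattice _ (leqnn _); rewrite take_size.
rewrite part_add_ME //.
have -> : #|[pred y | Phi f y == r]| = part nu r - part la r.
  rewrite -[in RHS](minnn (part nu r)) -(card_picture_row f_pict _ r_gt0).
  apply: eq_card => y; rewrite !inE ffunE; apply/esym/andb_idr => /eqP fy.
  by have [_ _] := picture_bounds f_pict y; rewrite fy.
rewrite subnKC //; have [->//|la_r] := posnP (part la r).
have := la_nu (r, part la r).
by rewrite !mem_cells r_gt0 la_r leqnn => /(_ isT).
Qed.

Theorem theorem4p1 (n : nat) (la mu nu : seq nat)
    (n_ge1 : 1 <= n)
    (la_young : young_diagram la) (la_rows : size la <= n)
    (mu_young : young_diagram mu) (mu_rows : size mu <= n)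
    (nu_young : young_diagram nu) (nu_rows : size nu <= n.+1)
    (la_sub_nu : {subset cells la <= cells nu})
    (card_eq : size (cells la) + size (cells mu) = size (cells nu)) :
  [/\ set_bij (pictures mu nu la) (LR_crystal n mu nu la) (@Phi mu),
      set_fun (LR_crystal n mu nu la) (pictures mu nu la) (@Psi la mu),
      forall f, pictures mu nu la f -> Psi la (Phi f) = f
    & forall T, LR_crystal n mu nu la T -> Phi (Psi la T) = T].
Proof.
have Phi_in f : pictures mu nu la f -> LR_crystal n mu nu la (Phi f).
  exact: Phi_LR.
have Psi_in T : LR_crystal n mu nu la T -> pictures mu nu la (Psi la T).
  by move=> T_LR; apply: (Psi_picture mu_young T_LR).
have PhiK f : pictures mu nu la f -> Psi la (Phi f) = f.
  by move=> f_pict; apply: (Psi_Phi f_pict).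
have PsiK T : Phi (Psi la T) = T by apply/ffunP => x; rewrite !ffunE.
split=> //; split=> [f|f g|T T_LR]; first exact: Phi_in.
  by rewrite !inE => f_pict g_pict fg; rewrite -(PhiK f) // fg PhiK.
by exists (Psi la T); [apply: Psi_in|].
Qed.
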